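(* Let $A\in\mathbb{R}^{N\times N}$ be a rank-$r$ HODLR matrix with cluster tree $\mathcal{T}_L$, all of whose off-diagonal blocks have the same rank $r$ and all of whose diagonal blocks have the same size $m=N/2^L$. Then the factorization of $A$ by the factorization algorithm described in the context requires (under the counting convention described there) the following amount of operations: $$t_f=\frac{2}{3}m^2N+2mrNL+\sum_{\ell=1}^{L}4r^2N\ell=\frac23 m^2N+2mrNL+2r^2N(L+L^2)=\mathcal{O}(r^2N\log^2 N),$$ where the asymptotic bound is for $m$ a constant independent of $N$ (so that $L=\mathcal{O}(\log N)$).
   Context: Cluster tree: given $\mathcal{I}=\{1,\dots,N\}$, a cluster tree $\mathcal{T}_L$ is a binary tree with levels $0,1,\dots,L$ and $2^\ell$ nodes at level $\ell$, in which every node $\nu$ stands for a nonempty consecutive subset $\mathcal{I}_\nu\subseteq\mathcal{I}$, the root stands for $\mathcal{I}$, and the subsets of two siblings partition the subset of their parent. HODLR matrix: $A$ is a HODLR matrix with respect to $\mathcal{T}_L$ if for every pair of siblings $\alpha,\beta$ in $\mathcal{T}_L$ the off-diagonal block $A(\mathcal{I}_\alpha,\mathcal{I}_\beta)$ has low rank, written $A(\mathcal{I}_\alpha,\mathcal{I}_\beta)=U_\alpha V_\beta^*$ with $U_\alpha$ and $V_\beta$ having $r$ columns. The diagonal blocks are $D_\alpha=A(\mathcal{I}_\alpha,\mathcal{I}_\alpha)$ for the $2^L$ leaf nodes $\alpha$, each of size $m\times m$. The bases are concatenated into two $N\times rL$ matrices $U_{\mathrm{big}},V_{\mathrm{big}}$: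 for a node $\nu$ at level $\ell\ge1$, $U_\nu$ (resp. $V_\nu$) occupies rows $\mathcal{I}_\nu$ and columns $r(\ell-1)+1,\dots,r\ell$. Factorization algorithm. Set $Y_{\mathrm{big}}\gets U_{\mathrm{big}}$; $Y_\nu$ denotes the subblock of $Y_{\mathrm{big}}$ in the position that $U_\nu$ has in $U_{\mathrm{big}}$. (1) For each leaf $\alpha$: compute the LU factorization of $D_\alpha$ and overwrite $Y_{\mathrm{big}}(\mathcal{I}_\alpha,:)\gets D_\alpha^{-1}Y_{\mathrm{big}}(\mathcal{I}_\alpha,:)$ ($rL$ right-hand sides). (2) For $\ell=L-1,\dots,0$ and each node $\gamma$ at level $\ell$ with children $\alpha,\beta$: form and LU-factorize $K_\gamma=\begin{pmatrix} V_\alpha^*Y_\alpha & I \\ I & V_\beta^*Y_\beta \end{pmatrix}$; solve $K_\gamma\begin{pmatrix} W_\alpha \\ W_\beta \end{pmatrix}=\begin{pmatrix} V_\alpha^*Y_{\mathrm{big}}(\mathcal{I}_\alpha,1:r\ell) \\ V_\beta^*Y_{\mathrm{big}}(\mathcal{I}_\beta,1:r\ell) \end{pmatrix}$; and update $Y_{\mathrm{big}}(\mathcal{I}_\gamma,1:r\ell)\gets Y_{\mathrm{big}}(\mathcal{I}_\gamma,1:r\ell)-\begin{pmatrix} Y_\alpha W_\alpha \\ Y_\beta W_\beta \end{pmatrix}$. Counting convention: LU factorization of an $m\times m$ matrix costs $\frac23m^3$ operations; solving one right-hand side with such a factorization costs $2m^2$ operations; multiplying an $n\times k$ real matrix by a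 $k\times p$ real matrix costs $2nkp$ operations. The rank $r$ is assumed small, so in step (2) the cost is taken to be dominated by the matrix-matrix products forming the right-hand sides and the updates (the cost of factorizing and solving with the small matrices $K_\gamma$ is neglected). For each level $\ell$ with $1\le\ell\le L$ these are counted as $2r^2N\ell$ operations for the right-hand sides plus $2r^2N\ell$ operations for the updates. *)

(* Defs.v *)
From HB Require Import structures.
From mathcomp Require Import all_boot all_order all_algebra.
From mathcomp Require Import all_classical all_reals all_analysis.
From mathcomp Require Import ring.
Set Implicit Arguments.
Unset Strict Implicit.
Unset Printing Implicit Defensive.
Import Order.TTheory GRing.Theory Num.Theory.
Import numFieldNormedType.Exports.
Local Open Scope ring_scope.

(* Real matrices over [R : realType], so that ^* is ^T.
   Indices are 0-based: the columns r(l-1)+1, ..., rl become r(l-1), ..., rl-1. *)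

(* The nodes of level l are numbered 0, ..., 2^l - 1; the children of node j of
   level l are the nodes 2j and 2j+1 of level l+1 (neither is assumed to hold
   the smaller indices).  Values outside l <= L, j < 2^l are irrelevant. *)
Record cluster_tree (N L : nat) := ClusterTree {
  cluster :> nat -> nat -> {set 'I_N};
  cluster_neq0 : forall l j, (l <= L)%N -> (j < 2 ^ l)%N ->
    cluster l j != finset.set0;
  cluster_consecutive : forall l j, (l <= L)%N -> (j < 2 ^ l)%N ->
    exists a b : nat, cluster l j = [set i : 'I_N | (a <= i < b)%N]%SET;
  cluster_root : cluster 0 0 = [set: 'I_N]%SET;
  cluster_childrenU : forall l j, (l < L)%N -> (j < 2 ^ l)%N ->
    cluster l j = cluster l.+1 j.*2 :|: cluster l.+1 j.*2.+1;
  cluster_childrenI : forall l j, (l < L)%N -> (j < 2 ^ l)%N ->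
    [disjoint cluster l.+1 j.*2 & cluster l.+1 j.*2.+1] }.

Section Blocks.
Variables (R : realType) (p q : nat).

(* X(I, J); [enum_val] lists an index set increasingly. *)
Definition subblock (I : {set 'I_p}) (J : {set 'I_q}) (X : 'M[R]_(p, q)) :
    'M[R]_(#|I|, #|J|) :=
  mxsub (fun i : 'I_#|I| => enum_val i) (fun j : 'I_#|J| => enum_val j) X.

(* The result of the assignment X(I, J) <- B. *)
Definition set_subblock (I : {set 'I_p}) (J : {set 'I_q})
    (B : 'M[R]_(#|I|, #|J|)) (X : 'M[R]_(p, q)) : 'M[R]_(p, q) :=
  \matrix_(i, j)
    if [pick u : 'I_#|I| * 'I_#|J| | (enum_val u.1 == i) && (enum_val u.2 == j)]
    is Some u then B u.1 u.2 else X i j.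
End Blocks.

(* The block column of the bases of level l >= 1, and the columns 1:rl. *)
Definition own_cols (r L l : nat) : {set 'I_(r * L)} :=
  [set k : 'I_(r * L) | (r * l.-1 <= k < r * l)%N]%SET.
Definition first_cols (r L l : nat) : {set 'I_(r * L)} :=
  [set k : 'I_(r * L) | (k < r * l)%N]%SET.

Section HODLR.
Variables (R : realType) (N L r : nat) (T : cluster_tree N L).

(* The basis of node j of level l inside the concatenated bases X. *)
Definition basis (X : 'M[R]_(N, r * L)) (l j : nat) :=
  subblock (T l j) (own_cols r L l) X.

(* A(I_a, I_b) = U_a V_b^* for all ordered pairs of siblings a, b.  The nodes of
   a level partition the rows, so concatenated bases U, V amount to an arbitrary
   choice of the U_nu, V_nu with r columns. *)
Definition hodlr (A : 'M[R]_N) (U V : 'M[R]_(N, r * L)) : Prop :=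
  forall l j, (l < L)%N -> (j < 2 ^ l)%N ->
    let a := j.*2 in let b := j.*2.+1 in
    subblock (T l.+1 a) (T l.+1 b) A = basis U l.+1 a *m (basis V l.+1 b)^T /\
    subblock (T l.+1 b) (T l.+1 a) A = basis U l.+1 b *m (basis V l.+1 a)^T.
End HODLR.

Definition offdiag_rank (R : realType) (N L : nat) (T : cluster_tree N L)
    (A : 'M[R]_N) (r : nat) : Prop :=
  forall l j, (l < L)%N -> (j < 2 ^ l)%N ->
    let a := j.*2 in let b := j.*2.+1 in
    \rank (subblock (T l.+1 a) (T l.+1 b) A) = r /\
    \rank (subblock (T l.+1 b) (T l.+1 a) A) = r.

Definition leaf_size (N L : nat) (T : cluster_tree N L) (m : nat) : Prop :=
  forall j, (j < 2 ^ L)%N -> #|T L j| = m.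

(* [Solve n k]: k right-hand sides with a factored n x n matrix.
   [Mul n k p]: an n x k matrix times a k x p matrix. *)
Inductive kernel := LU of nat | Solve of nat & nat | Mul of nat & nat & nat.

(* The role of a kernel call.  [Coupling]: assembling, factoring and solving with
   the matrices K.  [Rhs l], [Update l]: products V_a^* Y_big(I_a, _), resp.
   Y_a W_a, for a node a of level l. *)
Inductive stage := Leaf | Coupling | Rhs of nat | Update of nat.

Definition trace := seq (stage * kernel).

Section Counted.
Variable R : realType.

(* A value together with the kernel calls made to compute it. *)
Definition counted (X : Type) : Type := (X * trace)%type.

Definition ret (X : Type) (x : X) : counted X := (x, [::]).

Definition bind (X Y : Type) (c : counted X) (f : X -> counted Y) : counted Y :=
  let d := f c.1 in (d.1, c.2 ++ d.2).

Fixpoint foldc (S : Type) (f : S -> nat -> counted S) (x : S) (s : seq nat) :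
    counted S :=
  if s is i :: s' then bind (f x i) (fun y => foldc f y s') else ret x.

Definition mul (s : stage) (n k p : nat) (B : 'M[R]_(n, k)) (C : 'M[R]_(k, p)) :
    counted 'M[R]_(n, p) := (B *m C, [:: (s, Mul n k p)]).

(* A factorization is represented by the matrix it factors: it is only used
   through [solve]. *)
Definition lu (s : stage) (n : nat) (D : 'M[R]_n) : counted 'M[R]_n :=
  (D, [:: (s, LU n)]).

Definition solve (s : stage) (n k : nat) (D : 'M[R]_n) (B : 'M[R]_(n, k)) :
    counted 'M[R]_(n, k) := (invmx D *m B, [:: (s, Solve n k)]).
End Counted.

Notation "'letc' x ':=' c 'in' k" := (bind c (fun x => k))
  (at level 200, x name, c at level 100, k at level 200,
   format "'[v' 'letc'  x  ':='  c  'in' '/' k ']'").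

Section Algorithm.
Variables (R : realType) (N L r : nat) (T : cluster_tree N L).
Variables (A : 'M[R]_N) (U V : 'M[R]_(N, r * L)).

Definition leaf_step (Y : 'M[R]_(N, r * L)) (j : nat) :
    counted 'M[R]_(N, r * L) :=
  let I := T L j in
  let all_cols := [set: 'I_(r * L)]%SET in
  letc F := lu Leaf (subblock I I A) in
  letc X := solve Leaf F (subblock I all_cols Y) in
  ret (set_subblock X Y).

(* The step at node j of level l, with children a and b. *)
Definition merge_step (l : nat) (Y : 'M[R]_(N, r * L)) (j : nat) :
    counted 'M[R]_(N, r * L) :=
  let a := j.*2 in let b := j.*2.+1 in
  let Va := basis T V l.+1 a in let Vb := basis T V l.+1 b in
  let Ya := basis T Y l.+1 a in let Yb := basis T Y l.+1 b in
  let Za := subblock (T l.+1 a) (first_cols r L l) Y in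
  let Zb := subblock (T l.+1 b) (first_cols r L l) Y in
  letc Ga := mul Coupling Va^T Ya in
  letc Gb := mul Coupling Vb^T Yb in
  letc F := lu Coupling (block_mx Ga 1%:M 1%:M Gb) in
  letc Ra := mul (Rhs l.+1) Va^T Za in
  letc Rb := mul (Rhs l.+1) Vb^T Zb in
  letc W := solve Coupling F (col_mx Ra Rb) in
  letc Pa := mul (Update l.+1) Ya (usubmx W) in
  letc Pb := mul (Update l.+1) Yb (dsubmx W) in
  ret (set_subblock (Zb - Pb) (set_subblock (Za - Pa) Y)).

Definition factorize : counted 'M[R]_(N, r * L) :=
  letc Y := foldc leaf_step U (iota 0 (2 ^ L)) in
  foldc (fun Y l => foldc (merge_step l) Y (iota 0 (2 ^ l))) Y (rev (iota 0 L)).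
End Algorithm.

Section Counting.
Variable R : realType.

Definition flops (k : kernel) : R :=
  match k with
  | LU n => 2 / 3 * n%:R ^+ 3
  | Solve n k => 2 * n%:R ^+ 2 * k%:R
  | Mul n k p => 2 * n%:R * k%:R * p%:R
  end.

(* The products of a node a of level l are counted with the column range 1:rl of
   Y_big(I_a, :), i.e. including its own block column Y_a, although [merge_step]
   performs the right-hand side and update products on 1:r(l-1) only.  For rank r
   this is 2 r^2 l #|I_a| for each of the two products, hence 2 r^2 N l per level
   for the right-hand sides and as much for the updates: see [level_count]. *)
Definition charge (r : nat) (e : stage * kernel) : R :=
  match e with
  | (Leaf, k) => flops k
  | (Coupling, _) => 0
  | (Rhs l, Mul n k _) | (Update l, Mul n k _) => flops (Mul n k (r * l))
  | (_, k) => flops k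
  end.

Definition operation_count (r : nat) (t : trace) : R :=
  \sum_(e <- t) charge r e.
End Counting.

Lemma cluster_card_sum (N L : nat) (T : cluster_tree N L) (l : nat) :
  (l <= L)%N -> (\sum_(0 <= j < 2 ^ l) #|T l j|)%N = N.
Proof.
elim: l => [_|l IH lL]; first by rewrite expn0 big_nat1 cluster_root cardsT card_ord.
rewrite -[RHS]IH ?(ltnW lL) // expnS mul2n.
have -> : forall n (F : nat -> nat),
    (\sum_(0 <= j < n.*2) F j = \sum_(0 <= j < n) (F j.*2 + F j.*2.+1))%N.
  elim=> [|n IHn] F; first by rewrite !big_geq.
  by rewrite doubleS !big_nat_recr //= IHn addnA.
rewrite !big_nat; apply: eq_bigr => j /= jl.
rewrite (cluster_childrenU T lL jl) cardsU.
have /eqP-> : T l.+1 j.*2 :&: T l.+1 j.*2.+1 == finset.set0.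
  by rewrite finset.setI_eq0; exact: cluster_childrenI.
by rewrite cards0 subn0.
Qed.

Lemma level_count (R : realType) (N L r : nat) (T : cluster_tree N L)
    (l p : nat) : (l <= L)%N ->
  \sum_(0 <= j < 2 ^ l) charge R r (Rhs l, Mul r #|T l j| p) =
    2 * r%:R ^+ 2 * N%:R * l%:R /\
  \sum_(0 <= j < 2 ^ l) charge R r (Update l, Mul #|T l j| r p) =
    2 * r%:R ^+ 2 * N%:R * l%:R.
Proof.
move=> lL; rewrite -[in N%:R](cluster_card_sum T lL) natr_sum.
by split; rewrite mulr_sumr mulr_suml; apply: eq_bigr => j _ /=;
  rewrite natrM; ring.
Qed.

(* Main.v *)
(* The kernel calls depend only on the cluster tree, never on the matrix entries.
   Each leaf costs 2/3 m^3 + 2 m^2 r L, and merging at a node g of level l costs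
   4 r^2 (l+1) #|I_g|, because its children partition I_g; the nodes of a level
   partition {1, ..., N}, so this sums to 4 r^2 N (l+1) per level.  For the
   asymptotic bound, N >= 2 and N >= 2^L make ln N / ln 2 an upper bound for both
   1 and L. *)
Require Import Defs.
From HB Require Import structures.
From mathcomp Require Import all_boot all_order all_algebra.
From mathcomp Require Import all_classical all_reals all_analysis.
From mathcomp Require Import ring.
Set Implicit Arguments.
Unset Strict Implicit.
Unset Printing Implicit Defensive.
Import Order.TTheory GRing.Theory Num.Theory.
Import numFieldNormedType.Exports.
Local Open Scope classical_set_scope.
Local Open Scope ring_scope.

(** The trace of a merge records the width of a basis as [#|own_cols r L l.+1|], which has to be
    turned into the rank. Shifting by [r * l] maps ['I_r] onto the block column, which fits into the
    [r * L] columns since [l < L]. *)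
Lemma card_own_cols (r L l : nat) : (l < L)%N -> #|own_cols r L l.+1| = r.
Proof.
move=> lL; have le_rl : (r * l + r <= r * L)%N by rewrite -mulnSr leq_mul2l lL orbT.
pose f (i : 'I_r) : 'I_(r * L) := widen_ord le_rl (rshift (r * l) i).
have f_inj : injective f by move=> i j /(congr1 val) /addnI /val_inj.
rewrite -[RHS]card_ord -(card_imset _ f_inj); congr #|pred_of_set _|.
apply/setP => k; rewrite inE; apply/idP/imsetP => [/andP[lk kl]|[i _ ->]].
  have k_lt : (k - r * l < r)%N by rewrite ltn_subLR // -mulnSr.
  by exists (Ordinal k_lt) => //; apply: val_inj; rewrite /= subnKC.
by rewrite /= leq_addr mulnSr ltn_add2l ltn_ord.
Qed.

Lemma cluster_card_children (N L : nat) (T : cluster_tree N L) (l j : nat) :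
  (l < L)%N -> (j < 2 ^ l)%N ->
  (#|T l.+1 j.*2| + #|T l.+1 j.*2.+1|)%N = #|T l j|.
Proof.
move=> lL jl; rewrite (cluster_childrenU T lL jl) cardsU.
have /eqP-> : T l.+1 j.*2 :&: T l.+1 j.*2.+1 == finset.set0.
  by rewrite finset.setI_eq0; exact: cluster_childrenI.
by rewrite cards0 subn0.
Qed.

Section OperationCount.
Variables (R : realType) (r : nat).

Lemma operation_count_bind (X Y : Type) (c : counted X) (f : X -> counted Y) :
  operation_count R r (bind c f).2 =
  operation_count R r c.2 + operation_count R r (f c.1).2.
Proof. exact: big_cat. Qed.

(** A loop threads the matrix through its steps, so its cost splits into a plain sum because each
    step costs the same in every state [y]. Restricting this to [i \in s] makes the bounds on node
    numbers and levels available. *)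
Lemma operation_count_foldc (S : Type) (f : S -> nat -> counted S)
    (F : nat -> R) (s : seq nat) (x : S) :
  (forall y i, i \in s -> operation_count R r (f y i).2 = F i) ->
  operation_count R r (foldc f x s).2 = \sum_(i <- s) F i.
Proof.
elim: s x => [|i s IH] x fF; first by rewrite /operation_count !big_nil.
rewrite [LHS]operation_count_bind big_cons fF ?mem_head // IH // => y k ks.
by apply: fF; rewrite inE ks orbT.
Qed.

Variables (N L : nat) (T : cluster_tree N L).
Variables (A : 'M[R]_N) (U V : 'M[R]_(N, r * L)).

Lemma operation_count_leaf_step (Y : 'M[R]_(N, r * L)) (j : nat) :
  operation_count R r (leaf_step T A Y j).2 =
  2 / 3 * #|T L j|%:R ^+ 3 + 2 * #|T L j|%:R ^+ 2 * (r%:R * L%:R).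
Proof.
by rewrite /operation_count /= !big_cons big_nil /= cardsT card_ord natrM addr0.
Qed.

(** The four [Coupling] calls are free; what remains is one [Rhs] and one [Update] product per
    child, all charged at the children's level [l.+1]. *)
Lemma operation_count_merge_step (l : nat) (Y : 'M[R]_(N, r * L)) (j : nat) :
  (l < L)%N -> (j < 2 ^ l)%N ->
  operation_count R r (merge_step T V l Y j).2 =
  4 * r%:R ^+ 2 * #|T l j|%:R * l.+1%:R.
Proof.
move=> lL jl; rewrite -(cluster_card_children T lL jl).
rewrite /operation_count /= !big_cons big_nil /= card_own_cols // natrM natrD.
ring.
Qed.

Lemma operation_count_factorize (m : nat) :
  leaf_size T m -> N = (m * 2 ^ L)%N ->
  operation_count R r (factorize T A U V).2 =
  2 / 3 * m%:R ^+ 2 * N%:R + 2 * m%:R * r%:R * N%:R * L%:R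
  + \sum_(1 <= l < L.+1) 4 * r%:R ^+ 2 * N%:R * l%:R.
Proof.
move=> Tm NE; rewrite operation_count_bind; congr (_ + _).
  rewrite (operation_count_foldc (F := fun=>
      2 / 3 * m%:R ^+ 3 + 2 * m%:R ^+ 2 * (r%:R * L%:R))); last first.
    move=> Y j; rewrite mem_iota => jL.
    by rewrite operation_count_leaf_step Tm.
  (* There are [2 ^ L] leaves and [N = m * 2 ^ L], so the sum trades one factor [m] for [N]. *)
  rewrite big_const_seq count_predT size_iota iter_addr_0 -mulr_natr NE natrM.
  ring.
rewrite (operation_count_foldc (F := fun l =>
    4 * r%:R ^+ 2 * N%:R * l.+1%:R)); last first.
  move=> Y l; rewrite mem_rev mem_iota /= => lL.
  rewrite (operation_count_foldc (F := fun j =>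
      4 * r%:R ^+ 2 * #|T l j|%:R * l.+1%:R)); last first.
    by move=> Z j; rewrite mem_iota; exact: operation_count_merge_step.
  rewrite -[in RHS](cluster_card_sum T (ltnW lL)) natr_sum mulr_sumr mulr_suml.
  by rewrite /index_iota subn0.
(* Merges run from level [L - 1] down to [0], but the order does not affect the sum; counting by the
   children's level shifts the range to [1, ..., L]. *)
rewrite (perm_big (iota 0 L)) ?perm_rev //=.
by rewrite big_add1 /= /index_iota subn0.
Qed.

End OperationCount.

Lemma sumr_nat (R : realFieldType) (n : nat) :
  \sum_(1 <= l < n.+1) l%:R = (n%:R + n%:R ^+ 2) / 2 :> R.
Proof.
elim: n => [|n IH]; first by rewrite big_geq // expr0n addr0 mul0r.
by rewrite big_nat_recr //= IH -natr1; field.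
Qed.

Theorem theorem3 (R : realType) (m : nat) :
  (forall (N L r : nat) (T : cluster_tree N L) (A : 'M[R]_N)
      (U V : 'M[R]_(N, r * L)),
    N = (m * 2 ^ L)%N -> leaf_size T m ->
    hodlr T A U V -> offdiag_rank T A r ->
    let t_f := operation_count R r (factorize T A U V).2 in
    t_f = 2 / 3 * m%:R ^+ 2 * N%:R + 2 * m%:R * r%:R * N%:R * L%:R
          + \sum_(1 <= l < L.+1) 4 * r%:R ^+ 2 * N%:R * l%:R /\
    t_f = 2 / 3 * m%:R ^+ 2 * N%:R + 2 * m%:R * r%:R * N%:R * L%:R
          + 2 * r%:R ^+ 2 * N%:R * (L%:R + L%:R ^+ 2)) /\
  (exists C : R, \forall N \near \oo, forall L : nat, N = (m * 2 ^ L)%N ->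
    L%:R <= C * ln N%:R /\
    forall (r : nat) (T : cluster_tree N L) (A : 'M[R]_N)
      (U V : 'M[R]_(N, r * L)),
    (0 < r)%N -> leaf_size T m -> hodlr T A U V -> offdiag_rank T A r ->
    operation_count R r (factorize T A U V).2
      <= C * (r%:R ^+ 2 * N%:R * ln N%:R ^+ 2)).
Proof.
have count_closed (N L r : nat) (T : cluster_tree N L) (A : 'M[R]_N)
    (U V : 'M[R]_(N, r * L)) : N = (m * 2 ^ L)%N -> leaf_size T m ->
    operation_count R r (factorize T A U V).2 =
    2 / 3 * m%:R ^+ 2 * N%:R + 2 * m%:R * r%:R * N%:R * L%:R
    + 2 * r%:R ^+ 2 * N%:R * (L%:R + L%:R ^+ 2).
  move=> NE Tm; rewrite (operation_count_factorize A U V Tm NE).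
  by rewrite -mulr_sumr sumr_nat; field.
split=> [N L r T A U V NE Tm _ _ t_f|].
  by split; [exact: operation_count_factorize|exact: count_closed].
have ln2_gt0 : 0 < ln 2 :> R by rewrite ln_gt0 // ltr1n.
(* [c * ln N%:R] is the base-2 logarithm of [N]. *)
pose c : R := (ln 2)^-1; have c_gt0 : 0 < c by rewrite invr_gt0.
(* One summand per term of the count; the last is [4 = 2 * 2] because [L + L ^ 2] is at most twice
   the squared logarithm. *)
pose K : R := 2 / 3 * m%:R ^+ 2 + 2 * m%:R + 4.
have K_ge0 : 0 <= K.
  by rewrite /K !addr_ge0 ?mulr_ge0 ?exprn_ge0 ?invr_ge0 ?ler0n.
(* The same constant serves both claims: [c] bounds [L], [K * c ^+ 2] bounds the count, and both are
   nonnegative. From [N = 2] on the base-2 logarithm is at least 1. *)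
exists (c + K * c ^+ 2); exists 2%N => // N /= N_ge2 L NE.
have m_gt0 : (0 < m)%N by move: N_ge2; rewrite NE; case: (m).
have N_gt0 : 0 < N%:R :> R by rewrite ltr0n (leq_trans _ N_ge2).
have y_ge1 : 1 <= c * ln N%:R.
  by rewrite mulrC ler_pdivlMr // mul1r ler_ln ?posrE ?ltr0n ?ler_nat ?(ltnW N_ge2).
have y_geL : L%:R <= c * ln N%:R.
  rewrite mulrC ler_pdivlMr // mulrC mulr_natr -lnXn ?ltr0n //.
  rewrite ler_ln ?posrE ?exprn_gt0 ?ltr0n ?(ltnW N_ge2) // -natrX ler_nat NE.
  exact: leq_pmull.
have ln_ge0 : 0 <= ln N%:R :> R.
  by rewrite ln_ge0 // ler1n (leq_trans _ N_ge2).
split=> [|r T A U V r_gt0 Tm _ _].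
  by rewrite (le_trans y_geL) // mulrDl lerDl !mulr_ge0 ?exprn_ge0 // ltW.
rewrite count_closed //.
(* For [r = 0] the bound would vanish while the LU cost of the leaves would not. *)
have r_ge1 : 1 <= r%:R :> R by rewrite ler1n.
have m_ge0 : 0 <= m%:R :> R by [].
have L_ge0 : 0 <= L%:R :> R by [].
set y := c * ln N%:R in y_ge1 y_geL.
(* Since [r] and [y] are at least 1, every lower-order term can be raised to [r ^ 2 * y ^ 2]. *)
have r_le : r%:R <= r%:R ^+ 2 :> R by rewrite ler_eXnr.
have y_le : y <= y ^+ 2 by rewrite ler_eXnr.
have rL_le : r%:R * L%:R <= r%:R ^+ 2 * y ^+ 2.
  by rewrite ler_pM // (le_trans y_geL).
have r2_ge1 := le_trans r_ge1 r_le; have y2_ge1 := le_trans y_ge1 y_le.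
have one_le : 1 <= r%:R ^+ 2 * y ^+ 2 by exact: mulr_ege1.
have LL_le : r%:R ^+ 2 * (L%:R + L%:R ^+ 2) <= r%:R ^+ 2 * (2 * y ^+ 2).
  rewrite ler_wpM2l ?exprn_ge0 // mulr_natl mulr2n lerD ?(le_trans y_geL) //.
  by rewrite lerXn2r ?nnegrE // (le_trans L_ge0).
(* The factor [1] is kept so that the three summands match [one_le], [rL_le] and [LL_le]. *)
have -> : 2 / 3 * m%:R ^+ 2 * N%:R + 2 * m%:R * r%:R * N%:R * L%:R
    + 2 * r%:R ^+ 2 * N%:R * (L%:R + L%:R ^+ 2) =
    N%:R * (2 / 3 * m%:R ^+ 2 * 1 + 2 * m%:R * (r%:R * L%:R)
            + 2 * (r%:R ^+ 2 * (L%:R + L%:R ^+ 2))) :> R by ring.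
apply: (@le_trans _ _ (N%:R * (K * (r%:R ^+ 2 * y ^+ 2)))); last first.
  rewrite /y exprMn [leLHS](_ : _ =
    K * c ^+ 2 * (r%:R ^+ 2 * N%:R * ln N%:R ^+ 2)); last by ring.
  by rewrite ler_wpM2r ?lerDr ?(ltW c_gt0) ?mulr_ge0 ?exprn_ge0.
rewrite ler_wpM2l // /K [leRHS]mulrDl [X in _ <= X + _]mulrDl.
rewrite !lerD //.
- by rewrite ler_wpM2l // !mulr_ge0 ?exprn_ge0.
- by rewrite ler_wpM2l // mulr_ge0.
- rewrite (_ : 4 * _ = 2 * (r%:R ^+ 2 * (2 * y ^+ 2))); last by ring.
  by rewrite ler_wpM2l.
Qed.
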